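(* Let $(\mathcal{X},\mathscr{A})$ be a measurable space and, for each integer $k\ge1$, let $t_k:\mathcal{X}^k\to\mathbb{R}^m$ be measurable. Let $(\delta_1,\xi_1),(\delta_2,\xi_2),\ldots$ be independent copies of $(\delta,\xi)$, where $\delta$ is Bernoulli with parameter $p>0$ and $\xi$ is an $\mathcal{X}$-valued random variable. Let $T_{c,n}$ be the complete case statistic associated with the sequence $(t_n)$ and $H_n$ its distribution, and let $R_n$ be the distribution of $t_n(\tilde\xi_1,\ldots,\tilde\xi_n)$, where $\tilde\xi_1,\tilde\xi_2,\ldots$ are independent with common distribution the conditional distribution of $\xi$ given $\delta=1$. Then: (a) If the sequence $(R_n)$ is tight, so is the sequence $(H_n)$. (b) If $R_n$ converges weakly to some limit $L$, then $H_n$ converges weakly to the same limit $L$. (c) If $R_n$ converges weakly to point mass at $0$, then $T_{c,n}$ converges in probability to zero.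
   Context: The complete case statistic associated with $(t_n)$ is $$T_{c,n}=\sum_{A\subset\{1,\ldots,n\}}\Bigl\{\prod_{i\in A}\delta_i\Bigr\}\Bigl\{\prod_{i\notin A}(1-\delta_i)\Bigr\}t_{|A|}(\xi^A),$$ where $t_0(\xi^{\varnothing})$ is a (fixed) constant in $\mathbb{R}^m$, $|A|$ is the cardinality of $A$, and $\xi^A=(\xi_{i_1},\ldots,\xi_{i_k})$ with $i_1<\cdots<i_k$ the elements of the non-empty set $A$. *)

(* Defs.v *)
From HB Require Import structures.
From mathcomp Require Import all_boot all_order all_algebra finmap.
From mathcomp Require Import all_classical all_reals all_analysis.

Set Implicit Arguments.
Unset Strict Implicit.
Unset Printing Implicit Defensive.

Import Order.TTheory GRing.Theory Num.Theory.
Import numFieldNormedType.Exports.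

Local Open Scope classical_set_scope.
Local Open Scope ring_scope.

(* Borel sigma-algebra on matrices, hence on R^m = 'rV[R]_m *)
HB.instance Definition _ (R : realType) (m n : nat) :=
  Measurable.copy 'M[R]_(m, n)
    (g_sigma_algebraType (@open 'M[R]_(m, n))).

Section convergence_of_laws.
Context (R : realType) (m : nat).

Definition tight (M : set (probability 'rV[R]_m R)) :=
  forall e : R, 0 < e ->
    exists2 K : set 'rV[R]_m, compact K &
      forall mu, M mu -> (mu (~` K) <= e%:E)%E.

Definition weak_cvg (mu : nat -> probability 'rV[R]_m R)
    (L : probability 'rV[R]_m R) :=
  forall f : 'rV[R]_m -> R, continuous f -> bounded_fun f ->
    (\int[mu n]_x (f x)%:E)%E @[n --> \oo] --> (\int[L]_x (f x)%:E)%E.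

(* `|_| is the sup norm of 'rV[R]_m; any norm on R^m gives the same notion *)
Definition cvg_in_probability d (T : measurableType d) (P : probability T R)
    (Y : nat -> T -> 'rV[R]_m) (Y0 : T -> 'rV[R]_m) :=
  forall e : R, 0 < e ->
    P [set w | e <= `|Y n w - Y0 w|] @[n --> \oo] --> 0%E.

End convergence_of_laws.

Section independence.
Context d dS (T : measurableType d) (S : measurableType dS) (R : realType).

Definition mutually_independent (P : probability T R) (Y : nat -> T -> S) :=
  forall (J : {fset nat}) (B : nat -> set S), (forall i, measurable (B i)) ->
    P (\bigcap_(i in [set` J]) (Y i @^-1` B i)) =
    (\prod_(i <- J) P (Y i @^-1` B i))%E.

Definition independent_copies d0 (T0 : measurableType d0)
    (P : probability T R) (Y : nat -> T -> S)
    (P0 : probability T0 R) (Y0 : T0 -> S) :=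
  mutually_independent P Y /\
  forall i B, measurable B -> P (Y i @^-1` B) = P0 (Y0 @^-1` B).

(* law of Y given the event E; only meaningful when 0 < P E *)
Definition conditional_law (P : probability T R) (Y : T -> S) (E : set T)
    (B : set S) : \bar R :=
  (P (Y @^-1` B `&` E) / P E)%E.

End independence.

Section statistics.
Context d dX (T : measurableType d) (X : measurableType dX).
Context (R : realType) (m : nat).

(* [t 0] is a constant, as [0.-tuple X] has a single element (so that its
   measurability is no restriction). *)
Variable t : forall k, {mfun k.-tuple X >-> 'rV[R]_m}.

Section complete_case.
Variables (delta : nat -> {mfun T >-> bool}) (xi : nat -> {mfun T >-> X}).

(* [enum_val] lists the elements of [A] in increasing order. *)
Definition subsample n (A : {set 'I_n}) (w : T) : #|A|.-tuple X :=
  [tuple xi (enum_val j) w | j < #|A|].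

Definition complete_case n (w : T) : 'rV[R]_m :=
  \sum_(A : {set 'I_n})
    ((\prod_(i in A) (delta i w)%:R) *
     (\prod_(i | i \notin A) (1 - (delta i w)%:R))) *: t #|A| (subsample A w).

Lemma complete_caseE n w :
  complete_case n w = let A := [set i : 'I_n | delta i w]%SET in
                      t #|A| (subsample A w).
Proof.
rewrite /complete_case /=; set A0 := [set i : 'I_n | delta i w]%SET.
rewrite (bigD1 A0)//= [X in _ + X]big1 ?addr0 => [|A AA0].
  rewrite [X in X * _]big1 => [|i]; last by rewrite inE => ->.
  rewrite mul1r big1 ?scale1r// => i.
  by rewrite inE => /negbTE ->; rewrite subr0.
suff [i iA] : exists i : 'I_n, (i \in A) != delta i w.
  have [Ai|Ai] := boolP (i \in A); move: iA.
    rewrite Ai => /negPf di.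
    by rewrite (bigD1 i)//=; case: (delta i w) di => //; rewrite !mul0r scale0r.
  rewrite (negbTE Ai); case di : (delta i w) => // _.
  by rewrite [X in _ * X](bigD1 i)//= di subrr mul0r mulr0 scale0r.
apply/existsP; apply: contraR AA0 => /existsPn AA0.
by apply/eqP/setP => i; rewrite !inE; have /negPn/eqP := AA0 i.
Qed.

Lemma measurable_subsample n (A : {set 'I_n}) :
  measurable_fun setT (subsample A).
Proof.
apply/measurable_fun_tnthP => j.
rewrite (_ : _ \o _ = xi (enum_val j))//.
by apply/funext => w /=; rewrite tnth_mktuple.
Qed.

Lemma measurable_complete_case n : measurable_fun setT (complete_case n).
Proof.
move=> _ B mB; rewrite setTI.
have -> : complete_case n @^-1` B = \bigcup_(A in [set: {set 'I_n}])
    (\bigcap_(i in [set: 'I_n]) (delta i @^-1` [set i \in A]) `&`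
     (t #|A| \o subsample A) @^-1` B).
  apply/seteqP; split => w /=.
    rewrite complete_caseE => Bw; exists [set i : 'I_n | delta i w]%SET => //.
    by split=> // i _ /=; rewrite inE.
  move=> [A _ [dA Bw]]; rewrite complete_caseE.
  rewrite (_ : [set i : 'I_n | delta i w]%SET = A)//.
  by apply/setP => i; rewrite inE dA.
apply: fin_bigcup_measurable => // A _; apply: measurableI.
  apply: fin_bigcap_measurable => // i _.
  exact: measurable_funPTI.
have mtA : measurable_fun setT (t #|A| \o subsample A).
  apply: measurableT_comp; first exact: measurable_funP.
  exact: measurable_subsample.
by rewrite -[X in measurable X]setTI; exact: mtA.
Qed.

HB.instance Definition _ n :=
  isMeasurableFun.Build _ _ _ _ (complete_case n) (measurable_complete_case n).

End complete_case.

Section full_sample.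
Variable xi : nat -> {mfun T >-> X}.

Definition full_statistic n (w : T) : 'rV[R]_m :=
  t n [tuple xi j w | j < n].

Lemma measurable_full_statistic n : measurable_fun setT (full_statistic n).
Proof.
apply: (measurableT_comp (measurable_funP (t n))).
apply/measurable_fun_tnthP => j.
rewrite (_ : _ \o _ = xi j)//.
by apply/funext => w /=; rewrite tnth_mktuple.
Qed.

HB.instance Definition _ n :=
  isMeasurableFun.Build _ _ _ _ (full_statistic n)
    (measurable_full_statistic n).

End full_sample.

Definition complete_case_law (P : probability T R) delta xi n
  : probability 'rV[R]_m R := distribution P (complete_case delta xi n).

Definition full_law (P : probability T R) xi n
  : probability 'rV[R]_m R := distribution P (full_statistic xi n).

End statistics.

(* Main.v *)
Require Import Defs.
From HB Require Import structures.
From mathcomp Require Import all_boot all_order all_algebra finmap.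
From mathcomp Require Import all_classical all_reals all_analysis.
From mathcomp Require Import measurable_realfun lra.

Set Implicit Arguments.
Unset Strict Implicit.
Unset Printing Implicit Defensive.

Import Order.TTheory GRing.Theory Num.Theory.
Import numFieldNormedType.Exports.

Local Open Scope classical_set_scope.
Local Open Scope ring_scope.

(* Given the set A of complete cases, the subsample indexed by A is
   distributed as the first |A| terms of xit. As |A| is binomial, H_n is the
   mixture of R_0, ..., R_n with Binomial(n, p) weights, R_0 being a point mass.
   Tightness passes to mixtures; weak convergence does too because
   Binomial(n, p) puts vanishing mass on any bounded set of indices. *)

(** * Rectangles, laws on tuples and finite independence *)

Definition rectangle {U : Type} {n} (B : 'I_n -> set U) : set (n.-tuple U) :=
  [set x | forall i, B i (tnth x i)].

Lemma measurable_rectangle d (U : measurableType d) n (B : 'I_n -> set U) :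
  (forall i, measurable (B i)) -> measurable (rectangle B).
Proof.
move=> mB.
rewrite (_ : rectangle B =
    \bigcap_(i in [set: 'I_n]) ((@tnth n U)^~ i @^-1` B i)).
  apply: fin_bigcap_measurable => // i _; rewrite -[X in measurable X]setTI.
  by apply: measurable_tnth.
by apply/seteqP; split=> x Bx => [i _|i]; exact: Bx.
Qed.

(** The coordinate preimages that generate the product sigma-algebra are rectangles with all sides
    but one equal to [setT]. Unlike these preimages, rectangles are stable under intersection, which
    the uniqueness of measures requires of a generator. *)
Lemma measurable_tuple_rectangleE d (U : measurableType d) n :
  @measurable _ (n.-tuple U) = <<s [set C | exists2 B : 'I_n -> set U,
    forall i, measurable (B i) & C = rectangle B] >>.
Proof.
apply/seteqP; split; last first.
  apply: smallest_sub; first exact: sigma_algebra_measurable.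
  by move=> _ [B mB ->]; exact: measurable_rectangle.
apply: smallest_sub; first exact: smallest_sigma_algebra.
move=> C; rewrite -bigcup_seq => -[i _ [A mA <-]]; rewrite setTI.
apply: sub_sigma_algebra; exists (fun j => if j == i then A else setT).
  by move=> j; case: ifP.
apply/seteqP; split=> x /= => [Ax j|/(_ i)]; last by rewrite eqxx.
by case: eqP => // ->.
Qed.

(** Rectangles form a generating pi-system containing the whole space. Since [m1] is finite, the
    constant sequence [setT] is an admissible exhaustion. *)
Lemma tuple_measure_unique d (U : measurableType d) (R : realType) n
    (m1 m2 : {measure set (n.-tuple U) -> \bar R}) :
  (m1 setT < +oo)%E ->
  (forall B : 'I_n -> set U, (forall i, measurable (B i)) ->
    m1 (rectangle B) = m2 (rectangle B)) ->
  forall C, measurable C -> m1 C = m2 C.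
Proof.
move=> m1oo m12 C mC; apply: (measure_unique _ (fun=> setT)) mC.
- exact: measurable_tuple_rectangleE.
- move=> _ _ [B mB ->] [B' mB' ->]; exists (fun i => B i `&` B' i).
    by move=> i; exact: measurableI.
  apply/seteqP; split=> x /= => [[Bx B'x] i|BB']; split=> // i;
  by case: (BB' i).
- by move=> _; exists (fun=> setT) => //; apply/seteqP; split.
- exact: bigcup_const.
- by move=> _ [B mB ->]; exact: m12.
- by [].
Qed.

Lemma mutually_independent_ord d dS (T : measurableType d)
    (S : measurableType dS) (R : realType) (P : probability T R)
    (Y : nat -> T -> S) n (B : 'I_n -> set S) :
  mutually_independent P Y -> (forall i, measurable (B i)) ->
  P [set w | forall i : 'I_n, B i (Y i w)] =
    (\prod_(i < n) P (Y i @^-1` B i))%E.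
Proof.
move=> indY mB.
(* Independence is stated for families indexed by [nat], so [B] is extended by [setT] from [n] on;
   only the indices below [n] are then selected. *)
pose B' k := if insub k is Some i then B i else setT.
have B'E (i : 'I_n) : B' i = B i by rewrite /B' valK.
have := indY [fset x | x in iota 0 n]%fset B'.
rewrite (_ : \bigcap_(i in _) _ = [set w | forall i : 'I_n, B i (Y i w)]).
  move=> ->; last by move=> k; rewrite /B'; case: insub.
  rewrite (perm_big (index_iota 0 n)); last first.
    apply: uniq_perm; [exact: fset_uniq|exact: iota_uniq|].
    by move=> x; rewrite /index_iota subn0 !inE.
  by rewrite big_mkord; apply: eq_bigr => i _; rewrite B'E.
apply/seteqP; split=> [w Bw i|w Bw k].
  by rewrite -B'E; apply: Bw => /=; rewrite !inE mem_iota /= add0n.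
rewrite /= !inE mem_iota /= add0n => kn.
by have := Bw (Ordinal kn); rewrite -B'E.
Qed.

(** * Binomial averages of convergent sequences *)

Lemma binomial_pmf_generating (R : realType) n (p x : R) :
  \sum_(k < n.+1) binomial_pmf n p k * x ^+ k = (1 - p + p * x) ^+ n.
Proof.
rewrite exprDn; apply: eq_bigr => k _; rewrite /binomial_pmf exprMn.
by rewrite mulrnAl mulrAC mulrC.
Qed.

Lemma sum_binomial_pmf (R : realType) n (p : R) :
  \sum_(k < n.+1) binomial_pmf n p k = 1.
Proof.
have := binomial_pmf_generating n p 1.
rewrite mulr1 subrK expr1n => <-.
by apply: eq_bigr => k _; rewrite expr1n mulr1.
Qed.

(** Beyond some [K] the terms are within [e / 2] of [l]. The terms before [K] deviate by at most a
    constant [C], and their total weight tends to 0 because [p] is positive. *)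
Lemma binomial_mean_cvg (R : realType) (p : R) (a : nat -> R) (l : R) :
  0 < p <= 1 -> a k @[k --> \oo] --> l ->
  \sum_(k < n.+1) binomial_pmf n p k * a k @[n --> \oo] --> l.
Proof.
move=> /andP[p0 p1] al.
have w0 n k : 0 <= binomial_pmf n p k.
  by apply: binomial_pmf_ge0; rewrite ltW.
have [C C0 aC] : exists2 C : R, 0 <= C & forall k, `|a k - l| <= C.
  have /cvg_seq_bounded [M [_ /(_ (M + 1))]] := cvgP _ al.
  rewrite ltrDl ltr01 => /(_ isT) aM.
  exists (`|M + 1| + `|l|); first by rewrite addr_ge0.
  move=> k; rewrite (le_trans (ler_normB _ _))// lerD2r.
  by rewrite (le_trans (aM k I))// ler_norm.
apply/cvgrPdistC_le => /= e e0.
have [K _ aK] := (cvgrPdistC_le _ _).1 al (e / 2) (divr_gt0 e0 (ltr0Sn _ 1)).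
(* [2 ^ (K - k)] dominates the indicator of [k < K], and its binomial mean is
   given by the generating function at [1/2]. *)
have ak k : `|a k - l| <= e / 2 + C * 2 ^+ K * 2^-1 ^+ k.
  have [Kk|kK] := leqP K k.
    by rewrite (le_trans (aK k Kk))// lerDl mulr_ge0// ?mulr_ge0// exprn_ge0//.
  rewrite (le_trans (aC k))// ler_wpDl ?divr_ge0 ?(ltW e0)//.
  rewrite -mulrA ler_peMr// exprVn.
  by rewrite ler_pdivlMr ?exprn_gt0// mul1r ler_weXn2l// ?ler1n// ltnW.
have : C * 2 ^+ K * (1 - p + p * 2^-1) ^+ n @[n --> \oo] --> 0.
  rewrite -[X in _ --> X](mulr0 (C * 2 ^+ K)); apply: cvgMr.
  (* As [0 < p <= 1], the ratio [1 - p / 2] lies in [[1/2, 1)], so its powers vanish. *)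
  by apply: cvg_expr; rewrite ger0_norm; lra.
move=> /cvgrPdistC_le /(_ (e / 2) (divr_gt0 e0 (ltr0Sn _ 1))).
apply: filterS => n; rewrite subr0 => small.
(* The weights sum to 1, so [l] is its own binomial mean and the error is the mean of the
   differences [a k - l]. *)
rewrite -[l]mul1r -(sum_binomial_pmf n p) mulr_suml -sumrB.
rewrite (le_trans (ler_norm_sum _ _ _))//.
apply: (@le_trans _ _ (\sum_(k < n.+1) binomial_pmf n p k *
    (e / 2 + C * 2 ^+ K * 2^-1 ^+ k))).
  apply: ler_sum => k _; rewrite -mulrBr normrM ger0_norm//.
  by rewrite ler_wpM2l.
under eq_bigr do rewrite mulrDr [X in _ + X]mulrCA.
rewrite big_split/= -mulr_suml sum_binomial_pmf mul1r -mulr_sumr.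
rewrite binomial_pmf_generating [leRHS]splitr lerD2l.
by rewrite (le_trans (ler_norm _)).
Qed.

(** * The law of the complete case statistic as a binomial mixture *)

Section complete_case_mixture.
Context (R : realType) (m : nat) (dX : measure_display) (X : measurableType dX).
Context (t : forall k, {mfun k.-tuple X >-> 'rV[R]_m}) (p : R).
Context (d0 : measure_display) (T0 : measurableType d0) (P0 : probability T0 R).
Context (delta0 : {RV P0 >-> bool}) (xi0 : {RV P0 >-> X}).
Context (d : measure_display) (T : measurableType d) (P : probability T R).
Context (delta : nat -> {RV P >-> bool}) (xi : nat -> {RV P >-> X}).
Context (d' : measure_display) (T' : measurableType d') (P' : probability T' R).
Context (xit : nat -> {RV P' >-> X}).
Context (p01 : 0 < p <= 1).
Context (delta0_bernoulli : distribution P0 delta0 =1 bernoulli_prob p).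
Context (deltaxi_copies : independent_copies P (fun i w => (delta i w, xi i w))
  P0 (fun w => (delta0 w, xi0 w))).
Context (xit_indep : mutually_independent P' xit).
Context (xit_law : forall i B, measurable B -> distribution P' (xit i) B =
  conditional_law P0 xi0 (delta0 @^-1` [set true]) B).

Lemma prob_delta0 b : P0 (delta0 @^-1` [set b]) = (if b then p else 1 - p)%:E.
Proof.
have /andP[p0 p1] := p01.
rewrite -[LHS]/(distribution P0 delta0 [set b]) delta0_bernoulli.
by rewrite /bernoulli_prob (ltW p0) p1 fsbig_set1.
Qed.

(** The conditional law is a quotient by the probability [p] of a complete case; clearing it uses
    [p != 0]. *)
Lemma prob_delta0_xi0 i B : measurable B ->
  P0 (xi0 @^-1` B `&` delta0 @^-1` [set true]) =
  (p%:E * P' (xit i @^-1` B))%E.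
Proof.
have /andP[p0 p1] := p01.
move=> mB; rewrite -[P' _]/(distribution P' (xit i) B) xit_law//.
rewrite /conditional_law prob_delta0 muleC -muleA mulVe ?mule1//.
by rewrite eqe gt_eqF.
Qed.

Definition complete_set n w := [set i : 'I_n | delta i w]%SET.

(** The event constrains each pair [(delta i, xi i)] separately, so its probability is a product
    over [i]. An index in [A] contributes [p] times a probability for [xit], an index outside [A]
    contributes [1 - p]. *)
Lemma prob_complete_set_rectangle n (A : {set 'I_n}) (B : 'I_#|A| -> set X) :
  (forall j, measurable (B j)) ->
  P (subsample xi A @^-1` rectangle B `&` [set w | complete_set n w = A]) =
  ((p ^+ #|A| * (1 - p) ^+ (n - #|A|))%:E *
   P' [set w | forall j : 'I_#|A|, B j (xit j w)])%E.
Proof.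
move=> mB; have [indY lawY] := deltaxi_copies.
(* If [i] is the [j]-th element of [A], the intersection reduces to [B j], by injectivity of
   [enum_val]. If [i] is outside [A] it is empty, hence [setT], and [xi i] is unconstrained. *)
pose E (i : 'I_n) := [set i \in A] `*`
  \bigcap_(j in [set j | enum_val j = i]) B j.
have mE i : measurable (E i).
  apply: measurableX => //.
  by apply: fin_bigcap_measurable => [|j _]; first exact: finite_finset.
rewrite (_ : _ `&` _ = [set w | forall i : 'I_n, E i (delta i w, xi i w)]).
  have /= -> := mutually_independent_ord indY mE.
  have /= -> := mutually_independent_ord xit_indep mB.
  under eq_bigr => i _ do rewrite lawY//.
  rewrite (bigID (mem A)) /= EFinM muleAC; congr (_ * _)%E.
    (* Reindexing by [enum_val] matches the factors over [A] with the first [#|A|] terms of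
       [xit]. *)
    rewrite big_enum_val -[X in p ^+ X]card_ord -prodr_const -prodEFin.
    rewrite -big_split /=; apply: eq_bigr => j _.
    rewrite -prob_delta0_xi0//; congr (P0 _).
    apply/seteqP; split=> [w [/=]|w [/= Bw dw]].
      by rewrite enum_valP => -> /(_ j erefl).
    by split=> /= [|k /= /enum_val_inj ->]; rewrite ?enum_valP.
  transitivity (\prod_(i < n | i \notin A) (1 - p)%:E)%E.
    apply: eq_bigr => i iA; rewrite -(prob_delta0 false); congr (P0 _).
    apply/seteqP; split=> [w [/=]|w /= dw]; first by rewrite (negbTE iA).
    split=> /= [|k /= ki]; first by rewrite (negbTE iA).
    by move: iA; rewrite -ki enum_valP.
  rewrite prodEFin prodr_const; congr (_ ^+ _)%:E.
  by rewrite -[X in (X - _)%N](card_ord n) -(cardC A) addKn.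
apply/seteqP; split=> w.
  move=> [/= Bw Aw] i; split=> /=; first by rewrite -Aw inE.
  by move=> j <-; have := Bw j; rewrite tnth_mktuple.
move=> Ew; split=> [j|/=].
  by rewrite tnth_mktuple; have [_ /(_ j erefl)] := Ew (enum_val j).
by apply/setP => i; rewrite inE; have [/= -> _] := Ew i.
Qed.

Lemma measurable_complete_set n (A : {set 'I_n}) :
  measurable [set w | complete_set n w = A].
Proof.
rewrite (_ : [set _ | _] =
    \bigcap_(i in [set: 'I_n]) (delta i @^-1` [set i \in A])).
  by apply: fin_bigcap_measurable => // i _; exact: measurable_funPTI.
apply/seteqP; split=> [w /= <- i _ /=|w Aw]; first by rewrite inE.
by apply/setP => i; rewrite inE; exact: Aw.
Qed.

HB.instance Definition _ n (A : {set 'I_n}) :=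
  isMeasurableFun.Build _ _ _ _ (subsample xi A)
    (@measurable_subsample _ _ _ _ xi n A).

Definition sample n (w : T') : n.-tuple X := [tuple xit j w | j < n].

Lemma measurable_sample n : measurable_fun setT (@sample n).
Proof.
apply/measurable_fun_tnthP => j.
rewrite (_ : _ \o _ = xit j)//.
by apply/funext => w /=; rewrite tnth_mktuple.
Qed.

HB.instance Definition _ n :=
  isMeasurableFun.Build _ _ _ _ (@sample n) (@measurable_sample n).

(** Both sides are finite measures in [C]: the image under [subsample] of [P] restricted to one
    value of the complete set, and a multiple of the law of [sample]. They agree on rectangles,
    hence everywhere. *)
Lemma prob_subsample n (A : {set 'I_n}) : forall C, measurable C ->
  P (subsample xi A @^-1` C `&` [set w | complete_set n w = A]) =
  ((p ^+ #|A| * (1 - p) ^+ (n - #|A|))%:E * P' (@sample #|A| @^-1` C))%E.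
Proof.
have w0 : 0 <= p ^+ #|A| * (1 - p) ^+ (n - #|A|).
  by have /andP[p0 p1] := p01; rewrite mulr_ge0// exprn_ge0// ?subr_ge0// ltW.
change (forall C, measurable C ->
  pushforward (mrestr P (measurable_complete_set A)) (subsample xi A) C =
  mscale (NngNum w0) (distribution P' (@sample #|A|)) C).
apply: tuple_measure_unique.
  rewrite /= /pushforward /mrestr preimage_setT setTI.
  by rewrite -ge0_fin_numE// fin_num_measure//; exact: measurable_complete_set.
move=> B mB; rewrite /= /distribution /pushforward /mrestr /mscale /=.
rewrite prob_complete_set_rectangle//; congr (_ * P' _)%E.
by apply/seteqP; split=> w /= Bw j; have := Bw j; rewrite tnth_mktuple.
Qed.

(** The events [complete_set n w = A] partition the space, and the contribution of each depends on
    [A] only through its cardinality. *)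
Lemma complete_case_law_mixture n B : measurable B ->
  complete_case_law t P delta xi n B =
  (\sum_(k < n.+1) (binomial_pmf n p k)%:E * full_law t P' xit k B)%E.
Proof.
move=> mB.
transitivity (\sum_(A : {set 'I_n})
  ((p ^+ #|A| * (1 - p) ^+ (n - #|A|))%:E * full_law t P' xit #|A| B))%E.
  rewrite -[LHS]/(P (complete_case t delta xi n @^-1` B)).
  rewrite (_ : _ @^-1` _ = \bigcup_(A in [set` index_enum {set 'I_n}])
    (subsample xi A @^-1` (t #|A| @^-1` B) `&` [set w | complete_set n w = A])).
    rewrite measure_fin_bigcup//; last 2 first.
    - by move=> A A' _ _ [w [[_ <-] [_ <-]]].
    - move=> A _; apply: measurableI; last exact: measurable_complete_set.
      by apply: measurable_funPTI; exact: measurable_funPTI.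
    rewrite -fsbig_seq ?index_enum_uniq//=; apply: eq_bigr => A _.
    by rewrite prob_subsample//; exact: measurable_funPTI.
  apply/seteqP; split=> w /=; rewrite complete_caseE /=.
    by move=> Bw; exists (complete_set n w) => //=; rewrite mem_index_enum.
  by move=> [A _ [/[swap] <-]].
have cardA (A : {set 'I_n}) : (#|A| < n.+1)%N.
  by rewrite ltnS -[X in (_ <= X)%N](card_ord n) max_card.
(* Grouping the sets by cardinality [k] yields ['C(n, k)] equal terms, hence the binomial
   coefficient of the weight. *)
rewrite (partition_big (fun A => Ordinal (cardA A)) xpredT)//=.
apply: eq_bigr => k _.
rewrite (eq_bigr (fun=> ((p ^+ k * (1 - p) ^+ (n - k))%:E *
    full_law t P' xit k B)%E)); last by move=> A /eqP <-.
have card_k : #|[pred A : {set 'I_n} | Ordinal (cardA A) == k]| = 'C(n, k).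
  by rewrite -[X in 'C(X, _)](card_ord n) -card_draws cardsE; exact: eq_card.
rewrite sumr_const card_k /binomial_pmf -mulr_natl [in RHS]EFinM -[in RHS]muleA.
by rewrite mule_natl.
Qed.

End complete_case_mixture.

(** * Weak convergence of binomial mixtures *)

Lemma open_measurable_rV (R : realType) m (A : set 'rV[R]_m) :
  open A -> measurable A.
Proof. exact: sub_sigma_algebra. Qed.

Lemma continuous_measurable_rV (R : realType) m (f : 'rV[R]_m -> R) :
  continuous f -> measurable_fun setT f.
Proof.
move=> cf; apply: (measurability _ (RGenOInfty.measurableE R)).
move=> _ [_ [x ->] <-]; rewrite setTI; apply: open_measurable_rV.
by move/continuousP : cf; apply; exact: interval_open.
Qed.

Lemma bounded_continuous_integrable (R : realType) m
    (mu : probability 'rV[R]_m R) (f : 'rV[R]_m -> R) :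
  continuous f -> bounded_fun f -> mu.-integrable setT (EFin \o f).
Proof.
move=> cf bf; apply: measurable_bounded_integrable => //.
- by rewrite -ge0_fin_numE// fin_num_measure.
- exact: continuous_measurable_rV.
Qed.

(** Adding a bound [M] of [|f|] makes the test function nonnegative and shifts every integral by
    [M], since all the measures have mass 1. Integrals against mixtures can then be expanded by
    additivity for nonnegative functions. *)
Lemma weak_cvg_ge0 (R : realType) m (mu : nat -> probability 'rV[R]_m R)
    (L : probability 'rV[R]_m R) :
  (forall f : 'rV[R]_m -> R, continuous f -> bounded_fun f ->
    (forall x, 0 <= f x) ->
    (\int[mu n]_x (f x)%:E)%E @[n --> \oo] --> (\int[L]_x (f x)%:E)%E) ->
  weak_cvg mu L.
Proof.
move=> cvg_ge0 f cf bf.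
have [M fM] : exists M : R, forall x, `|f x| <= M.
  case: bf => N [_ /(_ (N + 1))]; rewrite ltrDl ltr01 => /(_ isT) fN.
  by exists (N + 1) => x; exact: fN.
pose g x := f x + M.
have cg : continuous g.
  by move=> x; apply: continuousD; [exact: cf|exact: cst_continuous].
have g0 x : 0 <= g x by rewrite -lerBlDr sub0r; have /ler_normlP[] := fM x; lra.
have bg : bounded_fun g.
  exists (M + M); split; first exact: num_real.
  move=> N MN x _ /=; rewrite (le_trans _ (ltW MN))//.
  rewrite (le_trans (ler_normD _ _))// lerD//.
  by rewrite ger0_norm// (le_trans _ (fM x)).
have int_shift (nu : probability 'rV[R]_m R) :
    (\int[nu]_x (f x)%:E = \int[nu]_x (g x)%:E - M%:E)%E.
  under [X in (_ = X - _)%E]eq_integral do rewrite EFinD.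
  rewrite (@integralD _ _ _ nu setT measurableT (EFin \o f) (cst M%:E)).
  - by rewrite integral_cst//= probability_setT mule1 addeK.
  - exact: bounded_continuous_integrable.
  - exact: finite_measure_integrable_cst.
rewrite int_shift; under eq_fun do rewrite int_shift.
by apply: cvgeB; [exact: fin_num_adde_defl|exact: cvg_ge0|exact: cvg_cst].
Qed.

Lemma ge0_integral_finite_mixture d (T : measurableType d) (R : realType)
    (nu : {measure set T -> \bar R}) (mu : nat -> {measure set T -> \bar R})
    N (w : nat -> R) (f : T -> \bar R) :
  (forall k, 0 <= w k) ->
  (forall B, measurable B -> nu B = (\sum_(k < N) (w k)%:E * mu k B)%E) ->
  measurable_fun setT f -> (forall x, 0 <= f x)%E ->
  (\int[nu]_x f x = \sum_(k < N) (w k)%:E * \int[mu k]_x f x)%E.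
Proof.
move=> w0 nuE mf f0.
rewrite (eq_measure_integral (msum (fun k => mscale (NngNum (w0 k)) (mu k)) N)).
  rewrite ge0_integral_measure_sum//; apply: eq_bigr => k _.
  by rewrite ge0_integral_mscale.
by move=> B mB _; exact: nuE.
Qed.

Lemma binomial_mixture_weak_cvg (R : realType) m (p : R)
    (mu nu : nat -> probability 'rV[R]_m R) (L : probability 'rV[R]_m R) :
  0 < p <= 1 ->
  (forall n B, measurable B ->
    nu n B = (\sum_(k < n.+1) (binomial_pmf n p k)%:E * mu k B)%E) ->
  weak_cvg mu L -> weak_cvg nu L.
Proof.
move=> p01 nuE muL; apply: weak_cvg_ge0 => f cf bf f0.
have intfin (la : probability 'rV[R]_m R) :
    (\int[la]_x (f x)%:E)%E \is a fin_num.
  by apply: integrable_fin_num => //; exact: bounded_continuous_integrable.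
(* All integrals are finite, [f] being bounded, so the claim becomes one about real sequences, to
   which [binomial_mean_cvg] applies. *)
have := muL f cf bf; rewrite -(fineK (intfin L)) => /fine_cvgP[_] cvg_fine.
have -> : (fun n => \int[nu n]_x (f x)%:E)%E = EFin \o (fun n =>
    \sum_(k < n.+1) binomial_pmf n p k * fine (\int[mu k]_x (f x)%:E)%E).
  apply/funext => n /=.
  rewrite (ge0_integral_finite_mixture (mu := fun k => mu k) _ (nuE n))//.
  - rewrite -sumEFin; apply: eq_bigr => k _.
    by rewrite EFinM fineK.
  - by move=> k; apply: binomial_pmf_ge0; have /andP[/ltW -> ->] := p01.
  - by apply/measurable_EFinP; exact: continuous_measurable_rV.
apply: cvg_EFin; first by apply: nearW.
exact: binomial_mean_cvg cvg_fine.
Qed.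

(** * Tightness of binomial mixtures *)

Lemma compact_measurable_rV (R : realType) m (K : set 'rV[R]_m) :
  compact K -> measurable K.
Proof.
move=> cK; rewrite -(setCK K); apply: measurableC; apply: open_measurable_rV.
by apply: closed_openC; apply: compact_closed => //; exact: norm_hausdorff.
Qed.

(** An average of numbers at most [e] is at most [e], so one compact set serves all mixtures. The
    assumed tightness leaves out [mu 0], which still has weight in the mixture; as it is
    concentrated at [c], adding [c] to the compact set suffices. *)
Lemma binomial_mixture_tight (R : realType) m (p : R)
    (mu nu : nat -> probability 'rV[R]_m R) c :
  0 < p <= 1 ->
  (forall n B, measurable B ->
    nu n B = (\sum_(k < n.+1) (binomial_pmf n p k)%:E * mu k B)%E) ->
  (forall B, measurable B -> ~ B c -> mu 0%N B = 0%E) ->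
  tight [set mu n | n in [set n | (0 < n)%N]] ->
  tight [set nu n | n in [set n | (0 < n)%N]].
Proof.
move=> p01 nuE mu0 tmu e e0; have [K cK Ke] := tmu e e0.
have cKc : compact (K `|` [set c]).
  by apply: compactU => //; exact: compact_set1.
have mKc := measurableC (compact_measurable_rV cKc).
exists (K `|` [set c]) => // _ [n _ <-].
have muKe k : (mu k (~` (K `|` [set c])) <= e%:E)%E.
  case: k => [|k]; first by rewrite mu0 ?lee_fin ?ltW//; apply; right.
  apply: (@le_trans _ _ (mu k.+1 (~` K))); last by apply: Ke; exists k.+1.
  apply: le_measure; rewrite ?inE//; last by apply: subsetC; left.
  by apply: measurableC; exact: compact_measurable_rV.
rewrite nuE//.
apply: (@le_trans _ _ (\sum_(k < n.+1) (binomial_pmf n p k)%:E * e%:E)%E).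
  apply: lee_sum => k _; apply: lee_wpmul2l => //.
  by rewrite lee_fin binomial_pmf_ge0//; have /andP[/ltW -> ->] := p01.
under eq_bigr do rewrite -EFinM.
by rewrite sumEFin -mulr_suml sum_binomial_pmf mul1r.
Qed.

(** * From weak convergence to a point mass to convergence in probability *)

Lemma weak_cvg_dirac_in_probability (R : realType) m d (T : measurableType d)
    (P : probability T R) (Y : nat -> {RV P >-> 'rV[R]_m}) c :
  weak_cvg (fun n => distribution P (Y n)) (@dirac _ 'rV[R]_m c R) ->
  cvg_in_probability P Y (fun=> c).
Proof.
(* The distance to [c] truncated at [e] is a bounded continuous test function that vanishes at [c],
   so its integrals tend to 0. *)
move=> Yc e e0; pose f (x : 'rV[R]_m) := Num.min `|x - c| e.
have f0 x : 0 <= f x by rewrite le_min normr_ge0 ltW.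
have cdist : continuous (fun x : 'rV[R]_m => `|x - c|).
  move=> x; apply: (@cvg_norm _ _ _ (nbhs x)).
  by apply: cvgB; [exact: cvg_id|exact: cvg_cst].
have cf : continuous f.
  move=> x; apply: (@continuous_min R _ (fun x : 'rV[R]_m => `|x - c|) (cst e));
    [exact: cdist|exact: cst_continuous].
have bf : bounded_fun f.
  exists e; split; first exact: num_real.
  by move=> M eM x _ /=; rewrite ger0_norm// ge_min (ltW eM) orbT.
have mf := continuous_measurable_rV cf.
have := Yc f cf bf.
rewrite integral_dirac//; last exact/measurable_EFinP.
rewrite diracT mul1e /f subrr normr0 min_l ?ltW// -/f => int0.
have {}int0 : (e^-1%:E * \int[distribution P (Y n)]_x (f x)%:E)%E
    @[n --> \oo] --> 0%E.
  by rewrite -(mule0 e^-1%:E); exact: cvgeZl.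
apply: (squeeze_cvge _ (cvg_cst 0%E) int0); apply: nearW => n.
rewrite measure_ge0 /=.
pose A := [set x : 'rV[R]_m | e <= `|x - c|].
rewrite -[P _]/(distribution P (Y n) A).
have mA : measurable A.
  rewrite (_ : A = (fun x => `|x - c|) @^-1` `[e, +oo[%classic).
    by rewrite -[X in measurable X]setTI; apply: continuous_measurable_rV.
  by apply/seteqP; split=> x; rewrite /A /= in_itv /= andbT.
(* Markov's inequality: once [e] is moved to the left, it remains to integrate the pointwise bound
   of [e] times the indicator of [A] by [f], which equals [e] on [A]. *)
rewrite -lee_pdivrMl ?invr_gt0// invrK.
rewrite -integral_cst// [leLHS]integral_mkcond.
apply: ge0_le_integral => //.
- by move=> x _; rewrite patchE; case: ifP => // _; rewrite lee_fin ltW.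
- by apply/(measurable_restrictT _ mA); exact: measurable_cst.
- exact/measurable_EFinP.
- move=> x _; rewrite patchE; case: ifPn => [/set_mem Ax|_]; rewrite lee_fin//.
  by rewrite /f min_r.
Qed.

Theorem corollary2p1 (R : realType) (m : nat)
  (dX : measure_display) (X : measurableType dX)
  (t : forall k, {mfun k.-tuple X >-> 'rV[R]_m})
  (p : R) (d0 : measure_display) (T0 : measurableType d0)
  (P0 : probability T0 R) (delta0 : {RV P0 >-> bool}) (xi0 : {RV P0 >-> X})
  (d : measure_display) (T : measurableType d) (P : probability T R)
  (delta : nat -> {RV P >-> bool}) (xi : nat -> {RV P >-> X})
  (d' : measure_display) (T' : measurableType d') (P' : probability T' R)
  (xit : nat -> {RV P' >-> X}) :
  0 < p <= 1 ->
  distribution P0 delta0 =1 bernoulli_prob p ->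
  independent_copies P (fun i w => (delta i w, xi i w))
                     P0 (fun w => (delta0 w, xi0 w)) ->
  mutually_independent P' xit ->
  (forall i B, measurable B ->
     distribution P' (xit i) B =
     conditional_law P0 xi0 (delta0 @^-1` [set true]) B) ->
  let H n := complete_case_law t P delta xi n in
  let Rn n := full_law t P' xit n in
  [/\ tight [set Rn n | n in [set n | (0 < n)%N]] ->
        tight [set H n | n in [set n | (0 < n)%N]],
      forall L : probability 'rV[R]_m R, weak_cvg Rn L -> weak_cvg H L
    & weak_cvg Rn (@dirac _ 'rV[R]_m 0 R) ->
        cvg_in_probability P (complete_case t delta xi) (fun=> 0)].
Proof.
move=> p01 delta0p copies indep law /=.
have mixture n B := @complete_case_law_mixture R m dX X t p d0 T0 P0 delta0 xi0
  d T P delta xi d' T' P' xit p01 delta0p copies indep law n B.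
split.
(* A [0.-tuple] is necessarily empty, so the statistic at size 0 is constant and its law is
   concentrated at [t 0 [tuple]]. *)
- apply: (binomial_mixture_tight (c := t 0 [tuple]) p01 mixture) => B mB Bc.
  rewrite /full_law/= /distribution /pushforward -[RHS](measure0 P').
  congr (P' _); apply/seteqP; split=> // w /=.
  by rewrite /full_statistic tuple0; move/Bc.
- by move=> L; exact: (binomial_mixture_weak_cvg p01 mixture).
- move=> /(binomial_mixture_weak_cvg p01 mixture).
  exact: (weak_cvg_dirac_in_probability (Y := complete_case t delta xi)).
Qed.
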